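(* Let $K$ be a field, let $m\le n$ be positive integers, and let $X=(X_{ij})$ be the $m\times n$ matrix of variables of the polynomial ring $K[X_{m\times n}]=K[X_{ij}: 1\le i\le m,\ 1\le j\le n]$. Let $\mathcal{M}_m\subset K[X_{m\times n}]$ be the set of $m$-minors of $X$ and let $G(m,n)=K[\mathcal{M}_m]$ be the $K$-subalgebra they generate. For every coherent matching $T$ of $\mathcal{M}_m$, the $K$-subalgebra $K[T]\subset K[X_{m\times n}]$ generated by the monomials in $T$ satisfies $$\dim K[T]=\dim G(m,n),$$ where $\dim$ denotes Krull dimension.
   Context: The $m$-minors of $X$ are the determinants of its $m\times m$ submatrices. For a finite list $F_1,\dots,F_s$ of nonzero polynomials, a matching is a list of monomials $X^{a_1},\dots,X^{a_s}$ such that $X^{a_i}$ is in the support of $F_i$ for every $i$. A matching is coherent if there is a monomial order $<$ on the polynomial ring such that $X^{a_i}=\operatorname{in}_<(F_i)$ is the initial (leading) monomial of $F_i$ for every $i$. *)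

(* Defs.v *)
From HB Require Import structures.
From mathcomp Require Import all_boot all_order all_algebra ring_quotient.
From mathcomp Require Import boolp.
From mathcomp Require Import mpoly.

Set Implicit Arguments.
Unset Strict Implicit.
Unset Printing Implicit Defensive.

Import GRing.Theory.
Local Open Scope ring_scope.

Definition strict_subset (T : eqType) (P Q : {pred T}) : Prop :=
  {subset P <= Q} /\ ~ {subset Q <= P}.

Definition prime_ideal (R : comNzRingType) (P : {pred R}) : Prop :=
  idealr_closed P /\ prime_idealr_closed P.

(* A chain P_0 < ... < P_d of prime ideals: its length is the number of strict
   inclusions. *)
Definition has_prime_chain (R : comNzRingType) (d : nat) : Prop :=
  exists P : 'I_d.+1 -> {pred R},
    (forall i, prime_ideal (P i)) /\
    (forall i j : 'I_d.+1, (i < j)%N -> strict_subset (P i) (P j)).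

Definition max_prime_chain (R : comNzRingType) (d : nat) : Prop :=
  has_prime_chain R d /\ forall e, has_prime_chain R e -> (e <= d)%N.

(* Supremum of the lengths of chains of prime ideals, with [None] standing for
   infinity. As R is nontrivial it has a prime ideal, so that the set of
   lengths is nonempty and has no maximum only if it is unbounded. *)
Definition krull_dim (R : comNzRingType) : option nat :=
  if pselect (exists d, max_prime_chain R d) is left ex
  then Some (projT1 (cid ex)) else None.

Section GeneratedSubalgebra.
Variables (K : comNzRingType) (A : comAlgType K) (S : {pred A}).

Definition gen_subalg : {pred A} :=
  fun x => `[< forall B : {pred A},
                 GRing.subalg_closed B -> {subset S <= B} -> x \in B >].

Fact gen_subalg_closed : GRing.subalg_closed gen_subalg.
Proof.
split=> [|a x y /asboolP xS /asboolP yS|x y /asboolP xS /asboolP yS].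
- by apply/asboolP=> B [].
- by apply/asboolP=> B cB sB; case: (cB) => _ lB _; apply: lB; auto.
- by apply/asboolP=> B cB sB; case: (cB) => _ _ mB; apply: mB; auto.
Qed.

HB.instance Definition _ :=
  GRing.isSubalgClosed.Build K A gen_subalg gen_subalg_closed.

Record subalg_of : predArgType :=
  SubalgOf { subalg_val : A; _ : subalg_val \in gen_subalg }.

HB.instance Definition _ := [isSub for subalg_val].
HB.instance Definition _ := [Choice of subalg_of by <:].
HB.instance Definition _ := [SubChoice_isSubComNzRing of subalg_of by <:].

End GeneratedSubalgebra.

Section Minors.
Variable R : comNzRingType.

(* The variables are the entries of X: X_ij is the variable numbered
   [mxvec_index i j]. *)
Definition generic_mx (m n : nat) : 'M[{mpoly R[m * n]}]_(m, n) :=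
  \matrix_(i, j) 'X_(mxvec_index i j).

Definition increasing (t n : nat) (f : {ffun 'I_t -> 'I_n}) : bool :=
  [forall i : 'I_t, forall j : 'I_t, (i < j)%N ==> (f i < f j)%N].

(* A t x t submatrix is given by increasing choices of t rows and t columns. *)
Definition minors (t m n : nat) (X : 'M[R]_(m, n)) : seq R :=
  [seq \det (mxsub f g X) | f : {ffun 'I_t -> 'I_m} <- enum (@increasing t m),
                            g : {ffun 'I_t -> 'I_n} <- enum (@increasing t n)].

End Minors.

Section Matchings.
Variables (R : comNzRingType) (k : nat).
Implicit Types (le : rel 'X_{1..k}) (p : {mpoly R[k]}) (a : 'X_{1..k}).
Implicit Types (F : seq {mpoly R[k]}) (T : seq 'X_{1..k}).

Definition monomial_order le : Prop :=
  [/\ total le, antisymmetric le, transitive le,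
      (forall a, le 0%MM a)
    & (forall a b c, le a b -> le (a + c)%MM (b + c)%MM)].

Definition is_initial le p a : bool :=
  (a \in msupp p) && all (fun b => le b a) (msupp p).

Definition matching F T : bool := all2 (fun p a => a \in msupp p) F T.

Definition coherent_matching F T : Prop :=
  matching F T /\
  exists le, monomial_order le /\ all2 (is_initial le) F T.

Definition monomials T : seq {mpoly R[k]} := [seq 'X_[a] | a <- T].

End Matchings.

(* Main.v *)
(* Both dimensions equal D = m (n - m) + 1.

   A chain of primes in a K-algebra in which any D + 1 elements are algebraically
   dependent has length at most D, and any D + 1 polynomials in D variables are
   dependent. So it is enough, for each algebra, to embed it in a polynomial ring
   in D variables and to exhibit a chain of length D, which is made of kernels of
   specializations of the variables.

   G(m, n) is invariant under SL_m, so it embeds by restriction to the matrices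
   (diag(t, 1, .., 1) | Y); its chain comes from Schubert varieties. For K[T] the
   same holds with D replaced by the rank of the exponents of T: the algebra
   embeds by setting to 1 all but a maximal set of independent coordinates, and
   setting the others to 1 one by one gives the chain.

   It remains to see that this rank is D. It is at most D because independent
   initial monomials come from algebraically independent minors. Conversely, let
   V be the span of T. Coherence gives the linkage property: for every set C of
   m + 1 columns and every row i there are c != c' in C with
   E_ic - E_ic' in V. Hence, modulo V, each row has at most m inequivalent
   entries, and codim V <= m^2 - 1 as any element of T is a further relation. *)
Require Import Defs.
From HB Require Import structures.
From mathcomp Require Import all_boot all_order all_algebra perm.
From mathcomp Require Import boolp mpoly zify ring.

Set Implicit Arguments.
Unset Strict Implicit.
Unset Printing Implicit Defensive.

Import Order.TTheory GRing.Theory Num.Theory.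
Local Open Scope ring_scope.

(** * Chains of prime ideals and algebraic dependence *)

(** An exponent [a] is recovered from its last entry and its restriction [r a], so each coefficient
    of [p] appears alone in [muni p]. *)
Lemma muni_eq0 n (R : nzRingType) (p : {mpoly R[n.+1]}) :
  (muni p == 0) = (p == 0).
Proof.
apply/eqP/eqP=> [p0|->]; last exact: raddf0.
apply/mpolyP=> a; rewrite mcoeff0; apply/eqP/contraT=> pa.
pose r (b : 'X_{1..n.+1}) := [multinom b (widen_ord (leqnSn n) i) | i < n].
have := congr1 (fun q : {poly {mpoly R[n]}} => (q`_(a ord_max))@_(r a)) p0.
rewrite muniE coef_sum raddf_sum coef0 mcoeff0 /=.
rewrite (bigD1_seq a) ?msupp_uniq ?mcoeff_msupp //= big1 => [|b ba].
  rewrite coefZ coefXn eqxx mulr1 mcoeffZ mcoeffX eqxx mulr1 addr0.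
  by move/eqP; rewrite (negPf pa).
rewrite coefZ coefXn; case: eqVneq => [eab|_]; last by rewrite mulr0 mcoeff0.
rewrite mulr1 mcoeffZ mcoeffX; case: eqVneq => [erb|_]; last by rewrite mulr0.
case/eqP: ba; apply/mnmP=> i.
have [j ->|->] := unliftP ord_max i; last by rewrite eab.
have -> : lift ord_max j = widen_ord (leqnSn n) j.
  by apply: val_inj; rewrite /= /bump leqNgt ltn_ord.
by move/mnmP/(_ j): erb; rewrite !mnmE.
Qed.

Lemma mmap_muni n (R : nzRingType) (B : comNzRingType) (f : {rmorphism R -> B})
    (x : 'I_n.+1 -> B) (p : {mpoly R[n.+1]}) :
  mmap f x p = (map_poly (mmap f (x \o widen_ord (leqnSn n))) (muni p)).[x ord_max].
Proof.
rewrite muniE rmorph_sum horner_sum /=; apply: eq_bigr => a _.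
rewrite -mul_mpolyC -mul_polyC rmorphM /= map_polyC map_polyXn /=.
rewrite -[_%:P * _]/(GRing.mul _ _) hornerCM hornerXn rmorphM /= mmapC mmapX /mmap1 big_ord_recr /=.
rewrite -mulrA; congr (_ * (_ * _)).
by apply: eq_bigr => i _; rewrite mnmE.
Qed.

Section PrimeIdeals.
Variables (B : comNzRingType) (P : {pred B}).
Hypothesis prP : prime_ideal P.

Lemma prime_ideal0 : 0 \in P. Proof. by case: prP => [[]]. Qed.
Lemma prime_ideal1 : 1 \notin P. Proof. by case: prP => [[]]. Qed.

Lemma prime_idealDM a u v : u \in P -> v \in P -> a * u + v \in P.
Proof. by case: prP => [[_ _ h] _]; apply: h. Qed.

Lemma prime_idealMl a u : u \in P -> a * u \in P.
Proof. by move=> uP; rewrite -[a * u]addr0 prime_idealDM ?prime_ideal0. Qed.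

Lemma prime_idealM u v : u * v \in P -> (u \in P) || (v \in P).
Proof. by case: prP => [_]; apply. Qed.

End PrimeIdeals.

(* Writing a nonzero polynomial in the last variable y as p'y + c, its value
   avoids P_0 : if c != 0 then already c(x) avoids P_1, which contains y, and
   if c = 0 then both y and p'(x, y) avoid P_0. *)
Lemma prime_chain_alg_indep (K : fieldType) (B : comNzRingType)
    (f : {rmorphism K -> B}) n (x : 'I_n -> B) (P : nat -> {pred B}) :
    (forall i, (i <= n)%N -> prime_ideal (P i)) ->
    (forall i, (i < n)%N -> {subset P i <= P i.+1}) ->
    (forall i : 'I_n, x i \in P (n - i)%N /\ x i \notin P (n - i.+1)%N) ->
  forall p : {mpoly K[n]}, p != 0 -> mmap f x p \notin P 0.
Proof.
elim: n x P => [|n IHn] x P prP subP xP p p0.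
  rewrite (nvar0_mpolyC p) mmapC; have pr0 := prP 0 isT.
  apply: contra (prime_ideal1 pr0) => /(prime_idealMl pr0 (f (p@_0)^-1)).
  rewrite -rmorphM mulVf ?rmorph1 // -(mpolyC_eq0 0) -?nvar0_mpolyC //.
(* For the first [n] variables the chain is shifted to start at [P 1], which leaves [P 0] to the
   last variable. *)
set x' := x \o widen_ord (leqnSn n).
have {}IHn q : q != 0 -> mmap f x' q \notin P 1.
  apply: (IHn x' (P \o S)) => [i|i|i]; [exact: (prP i.+1)|exact: (subP i.+1)|].
  have := xP (widen_ord (leqnSn n) i); rewrite /x' /= subSS.
  by rewrite /= subnSK // subSn // ltnW.
have [] := xP ord_max; rewrite subSnn subnn => x1 x0.
rewrite mmap_muni; move: p0; rewrite -muni_eq0; move: (muni p).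
have pr0 := prP 0 isT; have pr1 := prP 1 isT.
elim/poly_ind=> [|q c IHq]; first by rewrite eqxx.
have [-> q0|c0 _] := eqVneq c 0.
  rewrite addr0 rmorphM /= map_polyX hornerMX.
  apply/negP=> /(prime_idealM pr0); rewrite (negPf x0) orbF; apply/negP/IHq.
  by apply: contraNneq q0 => ->; rewrite mul0r addr0.
rewrite rmorphD rmorphM /= map_polyC map_polyX hornerD hornerMX hornerC /=.
apply: contra (IHn _ c0) => /(subP 0 isT) /= h.
move: h; set u := _.[_]; set v := mmap _ _ _ => h.
by rewrite -[v](addKr (u * x ord_max)) -mulNr prime_idealDM.
Qed.

Section KrullDimSubalg.
Variables (K : fieldType) (A : comAlgType K) (S : {pred A}).

Lemma in_alg_gen_subalg (c : K) : c%:A \in gen_subalg S.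
Proof. by case: (gen_subalg_closed S) => S1 SD _; rewrite -[c%:A]addr0 SD ?rpred0. Qed.

Definition subalg_scalar (c : K) : subalg_of S := SubalgOf (in_alg_gen_subalg c).

Fact subalg_scalar_is_zmod_morphism : zmod_morphism subalg_scalar.
Proof. by move=> a b; apply: val_inj; rewrite /= scalerBl. Qed.

Fact subalg_scalar_is_monoid_morphism : monoid_morphism subalg_scalar.
Proof.
by split=> [|a b]; apply: val_inj; rewrite /= ?scale1r // mulr_algl scalerA.
Qed.

HB.instance Definition _ := GRing.isZmodMorphism.Build K (subalg_of S)
  subalg_scalar subalg_scalar_is_zmod_morphism.
HB.instance Definition _ := GRing.isMonoidMorphism.Build K (subalg_of S)
  subalg_scalar subalg_scalar_is_monoid_morphism.

Lemma val_mmap_subalg n (x : 'I_n -> subalg_of S) (p : {mpoly K[n]}) :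
  val (mmap subalg_scalar x p) = mmap (in_alg A) (val \o x) p.
Proof.
rewrite rmorph_sum; apply: eq_bigr => a _; rewrite rmorphM rmorph_prod.
by congr (_ * _); apply: eq_bigr => i _; rewrite rmorphXn.
Qed.

(** A longer chain yields witnesses of its first [d.+1] strict inclusions, independent by
    [prime_chain_alg_indep]. Dependence is stated in [A] and passes to the subalgebra because [val]
    is injective. *)
Lemma leq_prime_chain d :
    (forall x : 'I_d.+1 -> A, (forall i, x i \in gen_subalg S) ->
      exists2 p : {mpoly K[d.+1]}, p != 0 & mmap (in_alg A) x p = 0) ->
  forall e, has_prime_chain (subalg_of S) e -> (e <= d)%N.
Proof.
move=> dep e [P [prP subP]]; rewrite leqNgt; apply/negP=> lt_de.
pose Q i := P (inord i).
have prQ i : prime_ideal (Q i) by apply: prP.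
have subQ i : (i < d.+1)%N -> strict_subset (Q i) (Q i.+1).
  by move=> lt_id; apply: subP; rewrite !inordK ?ltnS // (leq_trans _ lt_de) // ltnW.
have wit (i : 'I_d.+1) : {x | x \in Q (d.+1 - i)%N /\ x \notin Q (d.+1 - i.+1)%N}.
  have /subQ : (d.+1 - i.+1 < d.+1)%N by rewrite subSS ltnS leq_subr.
  rewrite subnSK // => -[_ /existsNP H]; apply: cid; case: H => x.
  by move=> /not_implyP[xQ /negP x'Q]; exists x.
have [//|p p0 px] := dep (fun i => val (sval (wit i))).
  by move=> i; apply: valP.
have /negP[] : mmap subalg_scalar (fun i => sval (wit i)) p \notin Q 0%N.
  apply: prime_chain_alg_indep p0 => [i _|i /subQ[]|i] //.
  exact: (svalP (wit i)).
suff -> : mmap subalg_scalar (fun i => sval (wit i)) p = 0.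
  exact: prime_ideal0 (prQ 0%N).
by apply: val_inj; rewrite val_mmap_subalg px.
Qed.

End KrullDimSubalg.

Lemma krull_dim_eq (R : comNzRingType) d :
    has_prime_chain R d -> (forall e, has_prime_chain R e -> (e <= d)%N) ->
  krull_dim R = Some d.
Proof.
move=> cd ub; rewrite /krull_dim; case: pselect => [ex|]; last by case; exists d.
case: (cid ex) => e [ce ube] /=; congr Some; apply/eqP.
by rewrite eqn_leq ub ?ube.
Qed.

Lemma prime_ideal_ker (R : comNzRingType) (S : idomainType)
  (f : {rmorphism R -> S}) : prime_ideal [pred x | f x == 0].
Proof.
split=> [|u v]; last by rewrite !inE rmorphM mulf_eq0.
split=> [||a u v]; rewrite !inE ?rmorph0 ?rmorph1 ?oner_eq0 //.
by rewrite rmorphD rmorphM => /eqP-> /eqP->; rewrite mulr0 addr0.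
Qed.

Lemma has_prime_chain_ker (K : fieldType) (A : comAlgType K) (S : {pred A})
    (D : idomainType) d (f : nat -> {rmorphism A -> D}) :
    (forall i x, (i < d)%N -> f i x = 0 -> f i.+1 x = 0) ->
    (forall i, (i < d)%N ->
      exists x, [/\ x \in gen_subalg S, f i x != 0 & f i.+1 x = 0]) ->
  has_prime_chain (subalg_of S) d.
Proof.
move=> subf wit; pose P (i : 'I_d.+1) : {pred subalg_of S} := [pred x | f i (val x) == 0].
exists P; split=> [i|i j lt_ij].
  exact: (prime_ideal_ker (f i \o (val : subalg_of S -> A))).
have le_f k l x : (k <= l <= d)%N -> f k x = 0 -> f l x = 0.
  elim: l => [|l IHl]; first by rewrite leqn0 => /andP[/eqP->].
  case/andP; rewrite leq_eqVlt => /predU1P[->//|]; rewrite ltnS => le_kl lt_ld.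
  by move=> fk0; apply: subf => //; apply: IHl => //; rewrite le_kl ltnW.
have le_jd : (j <= d)%N by rewrite -ltnS.
split=> [x|].
  by rewrite !inE => /eqP fi0; rewrite (le_f i) // le_jd ltnW.
have [x [xS fi fSi]] := wit i (leq_trans lt_ij le_jd).
move/(_ (SubalgOf xS)); rewrite !inE /= (le_f i.+1) ?lt_ij // eqxx => /(_ isT).
by rewrite (negPf fi).
Qed.

(** The choice of [k] works since (e k + 1)^D <= (e + 1)^D k^D < k^(D + 1). *)
Lemma card_box_ltn D e : exists k, ((e * k).+1 ^ D < k ^ D.+1)%N.
Proof.
exists (e.+1 ^ D).+1; set k := (e.+1 ^ D).+1.
apply: (@leq_ltn_trans ((e.+1 * k) ^ D)).
  case: (posnP D) => [->//|D_gt0].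
  by rewrite leq_exp2r // mulSn -[X in (X <= _)%N]add1n leq_add2r.
by rewrite expnMn expnS ltn_pmul2r // expn_gt0.
Qed.

Lemma mmap_sumX n (R : nzRingType) (B : comNzRingType) (f : {rmorphism R -> B})
    (x : 'I_n -> B) (I : finType) (c : I -> R) (a : I -> 'X_{1..n}) :
  mmap f x (\sum_i c i *: 'X_[a i]) = \sum_i f (c i) * mmap1 x (a i).
Proof.
rewrite rmorph_sum; apply: eq_bigr => i _.
by rewrite -mul_mpolyC rmorphM /= mmapC mmapX.
Qed.

Lemma leq_msizeM n (R : idomainType) (p q : {mpoly R[n]}) a b :
  (msize p <= a.+1 -> msize q <= b.+1 -> msize (p * q) <= (a + b).+1)%N.
Proof.
have [->|p0] := eqVneq p 0; first by rewrite mul0r msize0.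
have [->|q0] := eqVneq q 0; first by rewrite mulr0 msize0.
by move=> pa qb; rewrite msizeM //; lia.
Qed.

(* There are k^(D+1) products of powers < k of the q_i, and their exponents lie
   in a box of size O(k)^D. *)
Lemma mpoly_alg_dep (K : fieldType) D (q : 'I_D.+1 -> {mpoly K[D]}) :
  exists2 p : {mpoly K[D.+1]}, p != 0 & mmap (@mpolyC D K) q p = 0.
Proof.
pose e := (\sum_i msize (q i))%N.
have [k lt_k] := card_box_ltn D e.
pose mon (u : {ffun 'I_D.+1 -> 'I_k}) := [multinom u i : nat | i < D.+1].
pose box (v : {ffun 'I_D -> 'I_(e * k).+1}) := [multinom v i : nat | i < D].
pose M := \matrix_(i < #|{ffun 'I_D.+1 -> 'I_k}|, j < #|{ffun 'I_D -> 'I_(e * k).+1}|)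
   (mmap1 q (mon (enum_val i)))@_(box (enum_val j)).
have : kermx M != 0.
  rewrite kermx_eq0 /row_free neq_ltn (leq_ltn_trans (rank_leq_col M)) //.
  by rewrite !card_ffun !card_ord.
(* [M] has more rows than columns. A nonzero [c] in its left kernel gives the coefficients of the
   relation, which is nonzero because distinct [u] have distinct monomials [mon u]. *)
case/rowV0Pn=> c /sub_kermxP cM c0.
exists (\sum_i c 0 i *: 'X_[mon (enum_val i)]).
  have [i ci] : exists i, c 0 i != 0.
    apply/existsP; apply: contraNT c0 => /existsPn c0; apply/eqP/rowP=> i.
    by rewrite mxE; apply/eqP/negPn.
  apply: contraNneq ci => /(congr1 (mcoeff (mon (enum_val i)))).
  rewrite raddf_sum mcoeff0 (bigD1 i) //= big1 => [|j ji].
    by rewrite mcoeffZ mcoeffX eqxx mulr1 addr0 => /eqP.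
  rewrite mcoeffZ mcoeffX; case: eqP => [eji|]; last by rewrite mulr0.
  case/eqP: ji; apply: enum_val_inj; apply/ffunP=> l; apply: val_inj.
  by move/mnmP/(_ l): eji; rewrite !mnmE.
have deg_prod (a : 'X_{1..D.+1}) : (forall i, a i < k)%N ->
    (msize (mmap1 q a) <= (e * k).+1)%N.
  move=> ak; apply: leq_trans (_ : (\sum_i msize (q i) * a i).+1 <= _)%N.
    rewrite /mmap1; elim/big_ind2: _ => [|s p t r|i _]; rewrite ?msize1 //.
      exact: leq_msizeM.
    elim: (a i) => [|j IHj]; first by rewrite expr0 msize1.
    by rewrite exprS mulnS leq_msizeM.
  by rewrite ltnS /e big_distrl leq_sum // => i _; rewrite leq_mul2l ltnW ?orbT.
rewrite mmap_sumX; apply/mpolyP=> b; rewrite mcoeff0 raddf_sum /=.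
under eq_bigr do rewrite mcoeffCM.
(* Inside the box the coefficient is an entry of [c *m M]; outside it the degree exceeds [e * k],
   the bound for the products. *)
have [/forallP bk|/forallPn[l lb]] := boolP [forall l, b l < (e * k).+1]%N.
  have /matrixP/(_ 0 (enum_rank [ffun l => Ordinal (bk l)])) := cM.
  rewrite !mxE => cM0; rewrite -[RHS]cM0; apply: eq_bigr => i _.
  rewrite mxE enum_rankK; congr (_ * mcoeff _ _).
  by apply/mnmP=> l; rewrite mnmE ffunE.
rewrite big1 // => i _.
rewrite memN_msupp_eq0 ?mulr0 //; apply: msize_mdeg_ge.
apply: leq_trans (deg_prod _ _) _ => [j|]; first by rewrite mnmE.
rewrite -leqNgt in lb; rewrite mdegE (bigD1 l) //=.
by apply: leq_trans lb (leq_addr _ _).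
Qed.

Lemma rmorph_mmapE n (R : nzRingType) (B : comNzRingType)
    (f : {rmorphism {mpoly R[n]} -> B}) p :
  f p = mmap (f \o @mpolyC n R) (fun i => f 'X_i) p.
Proof.
rewrite {1}[p]mpolyE rmorph_sum; apply: eq_bigr => a _ /=.
rewrite -mul_mpolyC rmorphM mpolyXE_id rmorph_prod; congr (_ * _).
by apply: eq_bigr => i _; rewrite rmorphXn.
Qed.

Lemma eq_mmap n (R : nzRingType) (B : comNzRingType) (f1 f2 : R -> B)
    (x1 x2 : 'I_n -> B) p :
  f1 =1 f2 -> x1 =1 x2 -> mmap f1 x1 p = mmap f2 x2 p.
Proof.
by move=> ef ex; apply: eq_bigr => a _; rewrite ef (mmap1_eq _ ex).
Qed.

Lemma rmorph_mmap n (R : nzRingType) (B C : comNzRingType) (f : {rmorphism R -> B})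
    (g : {rmorphism B -> C}) (x : 'I_n -> B) p :
  g (mmap f x p) = mmap (g \o f) (g \o x) p.
Proof.
rewrite rmorph_sum; apply: eq_bigr => a _; rewrite rmorphM rmorph_prod.
by congr (_ * _); apply: eq_bigr => i _; rewrite rmorphXn.
Qed.

(** The substitution [y k.+1] absorbs [y k], so whatever [y k] kills is killed by [y k.+1], and the
    kernels increase. *)
Lemma has_prime_chain_specializations (K : fieldType) N (S : {pred {mpoly K[N]}}) d
    (y : nat -> 'I_N -> {mpoly K[N]}) :
    (forall k j, (k < d)%N -> mmap (@mpolyC N K) (y k.+1) (y k j) = y k.+1 j) ->
    (forall k, (k < d)%N -> exists p, [/\ p \in gen_subalg S,
      mmap (@mpolyC N K) (y k) p != 0 & mmap (@mpolyC N K) (y k.+1) p = 0]) ->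
  has_prime_chain (subalg_of S) d.
Proof.
move=> yS; apply: (@has_prime_chain_ker K {mpoly K[N]} S {mpoly K[N]} d
  (fun k => mmap (@mpolyC N K) (y k))) => k p lt_k /= yp.
move/(congr1 (mmap (@mpolyC N K) (y k.+1))): yp.
rewrite raddf0 rmorph_mmap => <-; apply: eq_mmap => [c|j]; first by rewrite /= mmapC.
by rewrite /= yS.
Qed.

Lemma mmap_gen_subalg (K : comNzRingType) (A : comAlgType K) (S : {pred A}) n
    (x : 'I_n -> A) (p : {mpoly K[n]}) :
  (forall i, x i \in gen_subalg S) -> mmap (in_alg A) x p \in gen_subalg S.
Proof.
move=> xS; rewrite rpred_sum // => a _; rewrite mulr_algl rpredZ //.
by rewrite rpred_prod // => i _; rewrite rpredX.
Qed.

Lemma subset_gen_subalg (K : comNzRingType) (A : comAlgType K) (S B : {pred A}) :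
  GRing.subalg_closed B -> {subset S <= B} -> {subset gen_subalg S <= B}.
Proof. by move=> cB sB x /asboolP; apply. Qed.

Lemma mem_gen_subalg (K : comNzRingType) (A : comAlgType K) (S : {pred A}) :
  {subset S <= gen_subalg S}.
Proof. by move=> x xS; apply/asboolP => B _; apply. Qed.

(** The images under [y] are [D.+1] polynomials in [D] variables, hence dependent. Their relation
    evaluated at [x] stays in the subalgebra, where [y] is injective. *)
Lemma subalg_alg_dep (K : fieldType) N D (S : {pred {mpoly K[N]}})
    (y : 'I_N -> {mpoly K[D]}) :
    (forall p, p \in gen_subalg S -> mmap (@mpolyC D K) y p = 0 -> p = 0) ->
  forall x : 'I_D.+1 -> {mpoly K[N]}, (forall i, x i \in gen_subalg S) ->
    exists2 p : {mpoly K[D.+1]}, p != 0 & mmap (in_alg {mpoly K[N]}) x p = 0.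
Proof.
move=> inj x xS; have [p p0 px] := mpoly_alg_dep (mmap (@mpolyC D K) y \o x).
exists p => //; apply: inj; first exact: mmap_gen_subalg.
rewrite rmorph_mmap -px; apply: eq_mmap => // c /=.
by rewrite alg_mpolyC mmapC.
Qed.

(** * The algebra of maximal minors *)

Lemma increasingP t n (f : {ffun 'I_t -> 'I_n}) :
  reflect (forall i j : 'I_t, (i < j)%N -> (f i < f j)%N) (increasing f).
Proof.
apply: (iffP forallP) => incf i; first by move=> j; apply/implyP/(forallP (incf i)).
by apply/forallP=> j; apply/implyP/incf.
Qed.

Lemma increasing_inj t n (f : {ffun 'I_t -> 'I_n}) :
  increasing f -> injective f.
Proof.
move=> /increasingP incf i j eij; apply: val_inj.
by case: (ltngtP i j) => // /incf; rewrite eij ltnn.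
Qed.

Lemma increasing_id m (f : {ffun 'I_m -> 'I_m}) : increasing f -> f =1 id.
Proof.
move=> /increasingP incf i.
have ge (k : nat) : forall j : 'I_m, k = j -> (k <= f j)%N.
  elim: k => // k IHk j ekj.
  have lt_km : (k < m)%N by rewrite (leq_trans _ (ltn_ord j)) // -ekj.
  have := IHk (Ordinal lt_km) erefl; have := incf (Ordinal lt_km) j.
  by rewrite -ekj leqnn => /(_ isT); lia.
have le (k : nat) : forall j : 'I_m, (j + k < m -> f j + k < m)%N.
  elim: k => [|k IHk] j; first by rewrite !addn0.
  move=> lt_jk; have lt_j1 : (j.+1 < m)%N by lia.
  have := IHk (Ordinal lt_j1); rewrite /= addSnnS => /(_ lt_jk).
  by have := incf j (Ordinal lt_j1); rewrite /= leqnn => /(_ isT); lia.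
apply: val_inj; apply/eqP; rewrite /= eqn_leq ge // andbT.
have lt_im := ltn_ord i; have := le (m.-1 - i)%N i; lia.
Qed.

(** By [increasing_id] the only choice of [m] rows among [m] is the identity. *)
Lemma mem_minors (R : comNzRingType) m n (X : 'M[R]_(m, n)) p :
  reflect (exists2 g : {ffun 'I_m -> 'I_n}, increasing g & p = \det (colsub g X))
          (p \in minors m X).
Proof.
apply: (iffP allpairsP) => [[[f g]] [/=]|[g incg ->]].
  rewrite !mem_enum => incf incg ->; exists g => //; congr (\det _).
  by apply/matrixP=> i j; rewrite !mxE (increasing_id incf).
exists ([ffun i => i], g); rewrite !mem_enum; split=> //=.
  by apply/increasingP=> i j; rewrite !ffunE.
by congr (\det _); apply/matrixP=> i j; rewrite !mxE ffunE.
Qed.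

Section EvalGeneric.
Variables (K : comNzRingType) (m n : nat) (B : comNzRingType) (f : {rmorphism K -> B}).

Definition mx_eval (Z : 'M[B]_(m, n)) : {mpoly K[m * n]} -> B :=
  mmap f (mxvec Z 0).

HB.instance Definition _ Z := GRing.RMorphism.on (mx_eval Z).

Lemma mx_evalDZ Z a p q :
  mx_eval Z (a *: p + q) = f a * mx_eval Z p + mx_eval Z q.
Proof. by rewrite rmorphD /= /mx_eval mmapZ. Qed.

Lemma mx_evalM Z : {morph mx_eval Z : p q / p * q}.
Proof. exact: rmorphM. Qed.

Lemma map_generic_mx Z : map_mx (mx_eval Z) (generic_mx K m n) = Z.
Proof. by apply/matrixP=> i j; rewrite !mxE /mx_eval mmapX mmap1U mxvecE. Qed.

Lemma mx_eval_minor t (h : 'I_t -> 'I_m) (g : 'I_t -> 'I_n) Z :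
  mx_eval Z (\det (mxsub h g (generic_mx K m n))) = \det (mxsub h g Z).
Proof. by rewrite -det_map_mx map_mxsub map_generic_mx. Qed.

(** Left multiplication by [h] multiplies every maximal minor by [\det h], and the polynomials with
    equal values at both matrices form a subalgebra. *)
Lemma mx_eval_SL (p : {mpoly K[m * n]}) (h : 'M[B]_m) (Z : 'M[B]_(m, n)) :
  p \in gen_subalg (mem (minors m (generic_mx K m n))) -> \det h = 1 ->
  mx_eval (h *m Z) p = mx_eval Z p.
Proof.
move=> pG h1.
pose P : {pred {mpoly K[m * n]}} := [pred q | mx_eval (h *m Z) q == mx_eval Z q].
suff : {subset gen_subalg (mem (minors m (generic_mx K m n))) <= P}.
  by move=> /(_ p pG)/eqP.
apply: subset_gen_subalg => [|q]; last first.
  case/mem_minors=> g _ ->; rewrite inE !mx_eval_minor.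
  have -> : mxsub id g (h *m Z) = h *m colsub g Z.
    by apply/matrixP=> i j; rewrite !mxE; apply: eq_bigr => k _; rewrite mxE.
  by rewrite det_mulmx h1 mul1r.
split=> [|a u v|u v]; rewrite !inE ?rmorph1 //.
  by rewrite !mx_evalDZ => /eqP-> /eqP->.
by rewrite !mx_evalM => /eqP-> /eqP->.
Qed.

End EvalGeneric.

Section NormalForm.
Variables (K : fieldType) (m r : nat).

Definition corner_diag (R : nzRingType) (c : R) : 'M[R]_m.+1 :=
  diag_mx (\row_j if j == 0 then c else 1).

Lemma det_corner_diag (R : comNzRingType) (c : R) : \det (corner_diag c) = c.
Proof.
rewrite det_diag (bigD1 0) //= big1 ?mxE ?mulr1 // => j /negPf j0.
by rewrite mxE j0.
Qed.

(* An m x n matrix whose left m x m block is invertible is the product of a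
   matrix in SL_m and a specialization of this one. *)
Definition normal_mx : 'M[{mpoly K[(m.+1 * r).+1]}]_(m.+1, m.+1 + r) :=
  row_mx (corner_diag 'X_ord0) (\matrix_(i, j) 'X_(lift ord0 (mxvec_index i j))).

Local Notation G := (minors m.+1 (generic_mx K m.+1 (m.+1 + r))).

(** Over the fraction field the left block of the generic matrix is invertible, of determinant [d].
    The matrix is [X1 *m corner_diag d^-1], of determinant 1, times [row_mx (corner_diag d) W]. By
    [mx_eval_SL] the value of [p] at the generic matrix, which is [p] itself, is its value at the
    second factor, a specialization of [normal_mx]. *)
Lemma normal_mx_inj p : p \in gen_subalg (mem G) ->
  mx_eval (@mpolyC (m.+1 * r).+1 K) normal_mx p = 0 -> p = 0.
Proof.
move=> pG p0; pose X := generic_mx K m.+1 (m.+1 + r).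
pose L := {fraction {mpoly K[m.+1 * (m.+1 + r)]}}.
pose iota : {rmorphism _ -> L} := @tofrac {mpoly K[m.+1 * (m.+1 + r)]}.
pose f : {rmorphism K -> L} := iota \o @mpolyC _ K.
pose XL := map_mx iota X; pose X1 := lsubmx XL; pose X2 := rsubmx XL.
have d0 : \det X1 != 0.
  have -> : X1 = map_mx iota (lsubmx X) by apply/matrixP=> i j; rewrite !mxE.
  rewrite det_map_mx /= tofrac_eq0; apply/eqP.
  move/(congr1 (mx_eval idfun (row_mx 1%:M 0))).
  rewrite -det_map_mx map_lsubmx map_generic_mx row_mxKl det1 rmorph0.
  by apply/eqP; rewrite oner_eq0.
have uX1 : X1 \in unitmx by rewrite unitmxE unitfE.
pose d := \det X1; pose W := corner_diag d *m invmx X1 *m X2.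
have eX : XL = (X1 *m corner_diag d^-1) *m row_mx (corner_diag d) W.
  have diagK : corner_diag d^-1 *m corner_diag d = 1%:M.
    rewrite mulmx_diag -diag_const_mx; congr diag_mx; apply/rowP=> j.
    by rewrite !mxE; case: eqP; rewrite ?mulVf ?mulr1.
  rewrite mul_mx_row /W !mulmxA -(mulmxA X1) diagK mulmx1 mulmxV // mul1mx.
  by rewrite hsubmxK.
apply/eqP; rewrite -tofrac_eq0 -[tofrac p]/(iota p) rmorph_mmapE.
rewrite (_ : mmap _ _ _ = mx_eval f XL p); last first.
  apply: eq_mmap => // k; case/mxvec_indexP: k => i j.
  by rewrite mxvecE !mxE.
rewrite eX mx_eval_SL //; last by rewrite det_mulmx det_corner_diag mulfV.
pose w (k : 'I_(m.+1 * r).+1) : L :=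
  if unlift ord0 k is Some k' then mxvec W 0 k' else d.
suff -> : mx_eval f (row_mx (corner_diag d) W) p =
    mmap f w (mx_eval (@mpolyC (m.+1 * r).+1 K) normal_mx p).
  by rewrite p0 rmorph0.
rewrite rmorph_mmap; apply: eq_mmap => [c|k] /=; first by rewrite mmapC.
case/mxvec_indexP: k => i j; rewrite !mxvecE.
rewrite -[j]splitK; case: (split j) => k /=; rewrite ?row_mxEl ?row_mxEr !mxE.
  rewrite rmorphMn /=; congr (_ *+ _).
  by case: (i == 0); rewrite ?rmorph1 // mmapX mmap1U /w unlift_none.
by rewrite mmapX mmap1U /w liftK mxvecE !mxE.
Qed.

End NormalForm.

(* Frobenius-Koenig: a zero block with r rows and s columns, r + s > n, kills
   every term of the expansion. *)
Lemma det_zero_block (R : comNzRingType) n (A : 'M[R]_n) (i0 : 'I_n) :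
  (forall i j : 'I_n, (i0 <= i)%N -> (j <= i0)%N -> A i j = 0) -> \det A = 0.
Proof.
move=> A0; rewrite /determinant big1 // => s _.
have [i le_i le_si] : exists2 i : 'I_n, (i0 <= i)%N & (s i <= i0)%N.
  apply/exists_inP; apply: contraT; rewrite negb_exists_in => /forall_inP lt_s.
  (* Otherwise [s] would map the rows from [i0] on injectively into the columns after [i0], which
     are one fewer. *)
  pose P := [set i : 'I_n | (i0 <= i)%N]; pose Q := [set i : 'I_n | (i0 < i)%N].
  have sQP : Q \proper P.
    apply/properP; split; last by exists i0; rewrite inE ?ltnn.
    by apply/subsetP=> i; rewrite !inE => /ltnW.
  have : s @: P \subset Q.
    by apply/subsetP=> _ /imsetP[i Pi ->]; move: Pi; rewrite !inE ltnNge; apply: lt_s.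
  by move/subset_leq_card; rewrite (card_imset _ perm_inj) leqNgt (proper_card sQP).
by rewrite (bigD1 i) //= A0 // mul0r mulr0.
Qed.

Section SchubertChain.
Variables (K : fieldType) (m r : nat).
Local Notation n := (m.+1 + r)%N.

(* The pivot columns of the k-th Schubert variety: starting from 0, .., m they
   move to the right one step at a time, the last row going first, until they
   reach r, .., m + r. *)
Definition pivot k i := (i + minn r (k - (m - i) * r))%N.

Lemma pivot_mono k i j : (i <= j)%N -> (pivot k i <= pivot k j)%N.
Proof.
move=> le_ij; rewrite /pivot.
have := leq_mul (leq_sub2l m le_ij) (leqnn r); lia.
Qed.

Lemma ltn_pivot k i j : (i < j)%N -> (pivot k i < pivot k j)%N.
Proof.
move=> lt_ij; rewrite /pivot.
have := leq_mul (leq_sub2l m (ltnW lt_ij)) (leqnn r); lia.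
Qed.

Lemma pivotS k i : (pivot k i <= pivot k.+1 i)%N.
Proof. by rewrite /pivot; lia. Qed.

(** Row [i] moves during the [r] steps that start at [(m - i) * r], so [m - k %/ r] is the row
    moving at step [k]. *)
Lemma pivot_ltnS k : (k < m.+1 * r)%N ->
  exists i : 'I_m.+1, (pivot k i < pivot k.+1 i)%N.
Proof.
move=> lt_k; have r0 : (0 < r)%N by case: r lt_k => //; rewrite muln0.
have lt_q : (k %/ r < m.+1)%N by rewrite ltn_divLR.
have lt_i : (m - k %/ r < m.+1)%N by rewrite ltnS leq_subr.
exists (Ordinal lt_i); rewrite /pivot /= ltn_add2l subKn //.
by have := divn_eq k r; have := ltn_pmod k r0; lia.
Qed.

(** Beyond [k = m.+1 * r] the matrix is zero: this extra specialization gives the last prime of the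
    chain, the kernel of evaluation at the origin. *)
Definition schubert_mx k : 'M[{mpoly K[m.+1 * n]}]_(m.+1, n) :=
  \matrix_(i, j) if (k <= m.+1 * r)%N && (pivot k i <= j)%N
                 then generic_mx K m.+1 n i j else 0.

(** The minor on the pivot columns of step [k] separates steps [k] and [k.+1]: its matrix is
    triangular with nonzero diagonal at the first, and singular at the second. *)
Lemma minors_prime_chain :
  has_prime_chain (subalg_of (mem (minors m.+1 (generic_mx K m.+1 n)))) (m.+1 * r).+1.
Proof.
apply: (@has_prime_chain_specializations K _ _ _
  (fun k => mxvec (schubert_mx k) 0)) => [k l lt_k|k lt_k].
  case/mxvec_indexP: l => i j; rewrite !mxvecE mxE; case: ifPn => [_|out_k].
    by rewrite mxE mmapX mmap1U mxvecE.
  rewrite raddf0 mxE ifF //; apply: contraNF out_k => /andP[lt_kr le_j].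
  by rewrite (ltnW lt_kr) (leq_trans (pivotS k i) le_j).
have piv_lt (s : 'I_m.+1) : (pivot k s < n)%N.
  by rewrite /pivot -addSn leq_add // geq_minl.
pose g := [ffun s => Ordinal (piv_lt s)].
have gE s : g s = pivot k s :> nat by rewrite ffunE.
have incg : increasing g.
  by apply/increasingP=> i j lt_ij; rewrite !gE ltn_pivot.
exists (\det (colsub g (generic_mx K m.+1 n))); split.
- by apply: mem_gen_subalg; apply/mem_minors; exists g.
- rewrite -/(mx_eval _ _) mx_eval_minor.
  pose W : 'M[K]_(m.+1, n) := \matrix_(i, j) (pivot k i == j)%:R.
  apply/eqP=> /(congr1 (mx_eval idfun W)); rewrite rmorph0 -det_map_mx.
  rewrite (_ : map_mx _ _ = 1%:M) ?det1; first by apply/eqP; rewrite oner_eq0.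
  apply/matrixP=> i s; rewrite !mxE -ltnS lt_k gE /=.
  have [->|ne_is] := eqVneq i s.
    by rewrite leqnn /mx_eval mmapX mmap1U mxvecE mxE gE eqxx.
  case: ifP => _; last by rewrite rmorph0.
  rewrite /mx_eval mmapX mmap1U mxvecE mxE gE.
  case: eqP => // /eqP; case: (ltngtP i s) => [lt|lt|/val_inj e].
  + by rewrite ltn_eqF // ltn_pivot.
  + by rewrite gtn_eqF // ltn_pivot.
  + by rewrite e eqxx in ne_is.
rewrite -/(mx_eval _ _) mx_eval_minor.
have [lt_kr|ge_kr] := ltnP k (m.+1 * r).
  have [i0 lt_i0] := pivot_ltnS lt_kr.
  (* Row [i0] moves beyond its old pivot, and the rows below start further right still: all vanish
     in the old pivot columns up to the [i0]-th. *)
  apply: (det_zero_block (i0 := i0)) => i s le_i le_s; rewrite !mxE gE.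
  rewrite ifF // lt_kr /= leqNgt (leq_ltn_trans (pivot_mono k le_s)) //.
  exact: leq_trans lt_i0 (pivot_mono _ le_i).
rewrite (_ : mxsub _ _ _ = 0) ?det0 //.
by apply/matrixP=> i s; rewrite !mxE ltnNge ge_kr.
Qed.

End SchubertChain.

(** * Monomial algebras *)

(** Exponents are natural numbers: a rational combination is scaled by a common denominator and
    split into its positive and negative parts. *)
Lemma rat_clear_denom s (c : 'I_s -> rat) :
  exists (d : nat) (u v : 'I_s -> nat),
    (0 < d)%N /\ forall i, c i * d%:R = (u i)%:R - (v i)%:R.
Proof.
pose d := \prod_i denq (c i).
have d_gt0 : 0 < d by apply: prodr_gt0.
pose z i := numq (c i) * \prod_(j | j != i) denq (c j).
exists `|d|%N, (fun i => if 0 <= z i then `|z i|%N else 0%N),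
  (fun i => if 0 <= z i then 0%N else `|z i|%N).
split=> [|i]; first by rewrite absz_gt0 lt0r_neq0.
have -> : c i * `|d|%N%:R = (z i)%:~R.
  rewrite -[_%:R]/((`|d|%N : int)%:~R) gtz0_abs // /d (bigD1 i) //= /z !intrM mulrA.
  by rewrite -numqE.
case: ifP => zi; rewrite ?subr0 ?sub0r.
  by rewrite -[_%:R]/((`|z i|%N : int)%:~R) gez0_abs.
rewrite -[_%:R]/((`|z i|%N : int)%:~R) -mulrNz lez0_abs ?opprK //.
by rewrite leNgt (contraFN _ zi) // => /ltW.
Qed.

Section Monomials.
Variables (K : fieldType) (N : nat) (T : seq 'X_{1..N}).

(** The entries are rational, so that ranks do not depend on the characteristic of [K]. *)
Definition mnm_row (a : 'X_{1..N}) : 'rV[rat]_N := \row_j (a j)%:R.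

Lemma mnm_row0 : mnm_row 0%MM = 0.
Proof. by apply/rowP=> j; rewrite !mxE mnm0E. Qed.

Lemma mnm_rowD a b : mnm_row (a + b)%MM = mnm_row a + mnm_row b.
Proof. by apply/rowP=> j; rewrite !mxE mnmDE natrD. Qed.

Definition exponent_mx : 'M[rat]_(size T, N) :=
  \matrix_(i, j) (nth 0%MM T i j)%:R.

Lemma row_exponent_mx i : row i exponent_mx = mnm_row (nth 0%MM T i).
Proof. by apply/rowP=> j; rewrite !mxE. Qed.

Lemma mnm_row_exponent_mx a : a \in T -> (mnm_row a <= exponent_mx)%MS.
Proof.
move=> aT; have lt_a : (index a T < size T)%N by rewrite index_mem.
have := row_sub (Ordinal lt_a) exponent_mx.
by rewrite row_exponent_mx /= nth_index.
Qed.

Local Notation S := (mem (monomials K T)).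

Lemma msupp_monomials p a :
  p \in gen_subalg S -> a \in msupp p -> (mnm_row a <= exponent_mx)%MS.
Proof.
pose P : {pred {mpoly K[N]}} :=
  [pred q | all (fun b => mnm_row b <= exponent_mx)%MS (msupp q)].
suff : {subset gen_subalg S <= P} by move=> sP /sP/allP; apply.
apply: subset_gen_subalg => [|_ /mapP[b bT ->]]; last first.
  by rewrite inE msuppX /= mnm_row_exponent_mx.
split=> [|c u v /allP uP /allP vP|u v /allP uP /allP vP].
- by rewrite inE msupp1 /= mnm_row0 sub0mx.
- apply/allP=> b /msuppD_le; rewrite mem_cat => /orP[/msuppZ_le/uP|/vP] //.
apply/allP=> _ /msuppM_le/allpairsP[[b1 b2] /= [/uP s1 /vP s2 ->]].
by rewrite mnm_rowD addmx_sub.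
Qed.

Local Notation r := (\rank exponent_mx^T).

Let J : 'I_r -> 'I_N := maxrankfun exponent_mx^T.

Let J_inj : injective J := @maxrankfun_inj _ _ _ exponent_mx^T.

(** Every column of [exponent_mx] is a combination, given by [C], of the independent columns chosen
    by [J]; the same formula recovers a vector of the row space from its coordinates in [J]. *)
Lemma mnm_row_inj_maxrank a b :
    (mnm_row a <= exponent_mx)%MS -> (mnm_row b <= exponent_mx)%MS ->
  (forall l, a (J l) = b (J l)) -> a = b.
Proof.
have /submxP[C defA] : (exponent_mx^T <= rowsub J exponent_mx^T)%MS.
  by rewrite (eq_maxrowsub exponent_mx^T).
have defA' : exponent_mx = colsub J exponent_mx *m C^T.
  apply: trmx_inj; rewrite trmx_mul trmxK [LHS]defA; congr (_ *m _).
  by apply/matrixP=> i j; rewrite !mxE.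
have key c : (mnm_row c <= exponent_mx)%MS -> mnm_row c = colsub J (mnm_row c) *m C^T.
  case/submxP=> u ->; rewrite [in LHS]defA' mulmxA.
  congr (_ *m _); apply/rowP=> l; rewrite !mxE.
  by apply: eq_bigr => i _; rewrite !mxE.
move=> /key ea /key eb eJ; have : mnm_row a = mnm_row b.
  by rewrite ea eb; congr (_ *m _); apply/rowP=> l; rewrite !mxE eJ.
by move=> e; apply/mnmP=> j; move/rowP/(_ j): e; rewrite !mxE => /eqP; rewrite eqr_nat => /eqP.
Qed.

Definition coord_var (j : 'I_N) : {mpoly K[r]} :=
  if [pick l | J l == j] is Some l then 'X_l else 1.

Lemma mmap1_coord_var a : mmap1 coord_var a = 'X_[[multinom a (J l) | l < r]].
Proof.
rewrite mpolyXE_id /mmap1 (bigID (mem (codom J))) /= [X in _ * X]big1 ?mulr1.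
  have uJ : uniq (codom J) by apply/injectiveP.
  rewrite -(big_uniq _ uJ) big_image /=; apply: eq_bigr => l _; rewrite mnmE /coord_var.
  by case: pickP => [l' /eqP/J_inj->//|/(_ l)]; rewrite eqxx.
move=> j jJ; rewrite /coord_var; case: pickP => [l /eqP eJ|_]; last by rewrite expr1n.
by rewrite -eJ codom_f in jJ.
Qed.

(** Restriction to [J] is injective on the exponents that occur, so distinct terms of [p] stay
    distinct. *)
Lemma coord_var_inj p : p \in gen_subalg S -> mmap (@mpolyC r K) coord_var p = 0 -> p = 0.
Proof.
move=> pS p0; apply/mpolyP=> a; rewrite mcoeff0; apply/eqP/contraT=> pa.
have aS : a \in msupp p by rewrite mcoeff_msupp.
move/(congr1 (mcoeff [multinom a (J l) | l < r])): p0.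
rewrite mcoeff0 raddf_sum /= (bigD1_seq a) ?msupp_uniq //= big1_seq => [|b /andP[ba bS]].
  by rewrite addr0 mmap1_coord_var mcoeffCM mcoeffX eqxx mulr1 => /eqP; rewrite (negPf pa).
rewrite mmap1_coord_var mcoeffCM mcoeffX; case: eqP; last by rewrite mulr0.
move/mnmP=> eJ; case/eqP: ba; apply: mnm_row_inj_maxrank.
- exact: msupp_monomials bS.
- exact: msupp_monomials aS.
by move=> l; have := eJ l; rewrite !mnmE.
Qed.

(** The columns in [J] are independent, so the unit vector at [l0] is a rational combination of the
    rows restricted to [J]. Clearing denominators and separating signs gives [a] and [b]. *)
Lemma exponent_mx_dual (l0 : 'I_r) :
  exists (d : nat) (a b : 'X_{1..N}),
    [/\ (0 < d)%N, 'X_[a] \in gen_subalg S, 'X_[b] \in gen_subalg S &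
        forall l, a (J l) = (b (J l) + d * (l == l0))%N].
Proof.
pose B := colsub J exponent_mx.
have fullB : row_full B.
  rewrite /row_full -mxrank_tr.
  have -> : B^T = rowsub J exponent_mx^T.
    by apply/matrixP=> i j; rewrite !mxE.
  exact: maxrowsub_free.
have /submxP[c ec] := submx_full (delta_mx 0 l0 : 'rV_r) fullB.
have [d [u [v [d_gt0 euv]]]] := rat_clear_denom (c 0).
pose comb (w : 'I_(size T) -> nat) := (\sum_(i < size T) nth 0%MM T i *+ w i)%MM.
have combS w : 'X_[comb w] \in gen_subalg S.
  rewrite /comb -mprodXnE rpred_prod // => i _; rewrite rpredX //.
  by apply: mem_gen_subalg; apply: map_f; rewrite mem_nth.
exists d, (comb u), (comb v); split=> // l; apply/eqP.
have combE w : (comb w (J l))%:R = \sum_i (w i)%:R * B i l :> rat.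
  rewrite /comb mnm_sumE natr_sum; apply: eq_bigr => i _.
  by rewrite mulmnE natrM !mxE mulrC.
rewrite -(eqr_nat rat) natrD natrM !combE; apply/eqP.
have -> : (l == l0)%:R = \sum_i c 0 i * B i l by move/rowP/(_ l): ec; rewrite !mxE eqxx.
rewrite mulr_sumr -big_split /=; apply: eq_bigr => i _.
have -> : (u i)%:R = c 0 i * d%:R + (v i)%:R by rewrite euv subrK.
by ring.
Qed.

(* All variables outside J are set to 1, and those of J one after the other. *)
Definition partial_var k (j : 'I_N) : {mpoly K[N]} :=
  if [exists l : 'I_r, (k <= l)%N && (J l == j)] then 'X_j else 1.

Lemma mmap1_partial_var k a : mmap1 (partial_var k) a =
  'X_[[multinom if [exists l : 'I_r, (k <= l)%N && (J l == j)] then a j else 0%N | j < N]].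
Proof.
rewrite mpolyXE_id; apply: eq_bigr => j _; rewrite mnmE /partial_var.
by case: ifP => _; rewrite ?expr1n ?expr0.
Qed.

(** Step [k] is separated from the next by a binomial whose two exponents differ on [J] only at the
    [k]-th coordinate, the one whose variable is then set to 1. *)
Lemma monomials_prime_chain : has_prime_chain (subalg_of S) r.
Proof.
apply: (@has_prime_chain_specializations K _ _ _ partial_var) => [k j _|k lt_k].
  rewrite {2}/partial_var; case: ifP => [_|/existsPn no_l].
    by rewrite mmapX mmap1U.
  rewrite rmorph1 /partial_var ifF //; apply/existsP=> -[l /andP[lt_l eJ]].
  by have := no_l l; rewrite eJ ltnW.
have [d [a [b [d_gt0 aS bS eab]]]] := exponent_mx_dual (Ordinal lt_k).
exists ('X_[a] - 'X_[b]); split; first by rewrite rpredB.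
  rewrite rmorphB /= !mmapX !mmap1_partial_var subr_eq0.
  apply/eqP=> /(congr1 (@msupp _ _)); rewrite !msuppX.
  move=> /(congr1 (fun s => head 0%MM s (J (Ordinal lt_k)))) /=.
  have ex_l : [exists l : 'I_r, (k <= l)%N && (J l == J (Ordinal lt_k))].
    by apply/existsP; exists (Ordinal lt_k); rewrite leqnn eqxx.
  rewrite !mnmE ex_l eab eqxx muln1; lia.
apply/eqP; rewrite rmorphB /= !mmapX !mmap1_partial_var subr_eq0; apply/eqP.
congr 'X_[_]; apply/mnmP=> j; rewrite !mnmE; case: existsP => // -[l /andP[lt_l /eqP<-]].
by rewrite eab -val_eqE /= gtn_eqF // muln0 addn0.
Qed.

Lemma krull_dim_monomials : krull_dim (subalg_of S) = Some (\rank exponent_mx).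
Proof.
rewrite -mxrank_tr; apply: krull_dim_eq; first exact: monomials_prime_chain.
apply: leq_prime_chain; apply: subalg_alg_dep; exact: coord_var_inj.
Qed.

End Monomials.

(** * Initial monomials *)

Lemma exists_max_seq (U V : eqType) (le : rel V) (f : U -> V) (s : seq U) :
    total le -> transitive le -> s != [::] ->
  exists2 x, x \in s & forall y, y \in s -> le (f y) (f x).
Proof.
move=> tot tr; have refl x : le x x by case/orP: (tot x x).
elim: s => // x [|y s] IHs _.
  by exists x => [|y]; rewrite mem_seq1 // => /eqP->.
have [//|z zs zmax] := IHs; case/orP: (tot (f x) (f z)) => [le_xz|le_zx].
  exists z; first by rewrite inE zs orbT.
  by move=> u; rewrite inE => /predU1P[->//|/zmax].
exists x; first exact: mem_head.
by move=> u; rewrite inE => /predU1P[->//|/zmax/tr]; apply.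
Qed.

Section MonomialOrder.
Variables (N : nat) (le : rel 'X_{1..N}).
Hypothesis le_ord : monomial_order le.

Lemma mnm_le_total : total le. Proof. by case: le_ord. Qed.
Lemma mnm_le_anti : antisymmetric le. Proof. by case: le_ord. Qed.
Lemma mnm_le_trans : transitive le. Proof. by case: le_ord. Qed.
Lemma mnm_le_refl : reflexive le.
Proof. by move=> a; case/orP: (mnm_le_total a a). Qed.

Lemma mnm_le_add2r c a b : le (a + c)%MM (b + c)%MM = le a b.
Proof.
have [_ anti _ _ addr] := le_ord.
apply/idP/idP=> [le_ac|]; last exact: addr.
case/orP: (mnm_le_total a b) => // le_ba.
have /addIm -> : (a + c)%MM = (b + c)%MM by apply: anti; rewrite le_ac addr.
exact: mnm_le_refl.
Qed.

Lemma mnm_le_add2l c a b : le (c + a)%MM (c + b)%MM = le a b.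
Proof. by rewrite !(addmC c) mnm_le_add2r. Qed.

Section Initial.
Variable K : idomainType.
Implicit Types p q : {mpoly K[N]}.

Lemma is_initialP p a :
  reflect (p@_a != 0 /\ forall b, p@_b != 0 -> le b a) (is_initial le p a).
Proof.
rewrite -mcoeff_msupp; apply: (iffP andP) => -[pa].
  by move/allP=> max; split=> // b; rewrite -mcoeff_msupp => /max.
by move=> max; split=> //; apply/allP=> b; rewrite mcoeff_msupp => /max.
Qed.

Lemma is_initial1 : is_initial le (1 : {mpoly K[N]}) 0%MM.
Proof. by rewrite /is_initial msupp1 mem_head /= mnm_le_refl. Qed.

(** If [c + d = a + b] with [c] at most [a] and [d] at most [b], then [c = a]: a single pair of
    terms contributes to the leading coefficient, nonzero in a domain. *)
Lemma is_initialM p q a b :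
  is_initial le p a -> is_initial le q b -> is_initial le (p * q) (a + b)%MM.
Proof.
case/is_initialP=> pa maxa /is_initialP[qb maxb].
have maxp c : c \in msupp p -> le c a by rewrite mcoeff_msupp; apply: maxa.
have maxq c : c \in msupp q -> le c b by rewrite mcoeff_msupp; apply: maxb.
apply/is_initialP; split.
  rewrite mpolyME raddf_sum /= big_allpairs /= (bigD1_seq a) ?msupp_uniq ?mcoeff_msupp //=.
  rewrite (bigD1_seq b) ?msupp_uniq ?mcoeff_msupp //= mcoeffZ mcoeffX eqxx mulr1.
  rewrite big1_seq ?addr0 => [|d /andP[db dq]]; last first.
    by rewrite mcoeffZ mcoeffX eqm_add2l (negPf db) mulr0.
  rewrite big1_seq ?addr0 ?mulf_neq0 // => c /andP[ca cp].
  rewrite big1_seq // => d /andP[_ dq]; rewrite mcoeffZ mcoeffX.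
  case: eqVneq => [ecd|]; last by rewrite mulr0.
  case/eqP: ca; apply: mnm_le_anti; rewrite maxp //=.
  by rewrite -(mnm_le_add2r b) -ecd mnm_le_add2l maxq.
move=> c; rewrite -mcoeff_msupp => /msuppM_le/allpairsP[[c1 c2] /= [/maxp le1 /maxq le2 ->]].
by apply: (mnm_le_trans (y := (a + c2)%MM)); rewrite ?mnm_le_add2r ?mnm_le_add2l.
Qed.

Lemma is_initialX p a k : is_initial le p a -> is_initial le (p ^+ k) (a *+ k)%MM.
Proof.
move=> pa; elim: k => [|k IHk]; first exact: is_initial1.
by rewrite exprS mulmS is_initialM.
Qed.

Lemma is_initial_mmap1 s (F : 'I_s -> {mpoly K[N]}) (a : 'I_s -> 'X_{1..N}) u :
    (forall i, is_initial le (F i) (a i)) ->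
  is_initial le (mmap1 F u) (\sum_(i < s) a i *+ u i)%MM.
Proof.
move=> Fa; rewrite /mmap1; elim/big_rec2: _ => [|i b p _ pb]; first exact: is_initial1.
by apply: is_initialM => //; apply: is_initialX.
Qed.

(* Distinct monomials in the F i have distinct initial monomials, so that
   nothing cancels the largest one. *)
Lemma initial_alg_indep s (F : 'I_s -> {mpoly K[N]}) (a : 'I_s -> 'X_{1..N}) :
    (forall i, is_initial le (F i) (a i)) ->
    (forall u v : 'X_{1..s}, (\sum_(i < s) a i *+ u i)%MM = (\sum_(i < s) a i *+ v i)%MM ->
       u = v) ->
  forall p : {mpoly K[s]}, p != 0 -> mmap (@mpolyC N K) F p != 0.
Proof.
move=> Fa inj p p0; pose L (u : 'X_{1..s}) := (\sum_(i < s) a i *+ u i)%MM.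
have [|u up umax] := exists_max_seq L mnm_le_total mnm_le_trans (s := msupp p).
  by rewrite msupp_eq0.
apply/eqP=> /(congr1 (mcoeff (L u))); rewrite mcoeff0 raddf_sum /=.
rewrite (bigD1_seq u) ?msupp_uniq //= big1_seq ?addr0 => [|v /andP[vu vp]].
  rewrite mcoeffCM => /eqP; rewrite mulf_eq0 mcoeff_eq0 up /=.
  by case/is_initialP: (is_initial_mmap1 u Fa) => /negPf->.
rewrite mcoeffCM; case: (is_initialP _ _ (is_initial_mmap1 v Fa)) => _ maxv.
have [-> |/maxv le_uv] := eqVneq (mmap1 F v)@_(L u) 0; first by rewrite mulr0.
by case/eqP: vu; apply: inj; apply: mnm_le_anti; rewrite umax.
Qed.

End Initial.
End MonomialOrder.

Lemma row_free_rowsub (F : fieldType) m n p (f : 'I_p -> 'I_m) (A : 'M[F]_(m, n)) :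
  injective f -> row_free A -> row_free (rowsub f A).
Proof.
move=> f_inj /row_freeP[B AB]; apply/row_freeP; exists (B *m colsub f 1%:M).
rewrite mul_rowsub_mx mulmxA AB mul1mx.
by apply/matrixP=> i j; rewrite !mxE (inj_eq f_inj).
Qed.

(** More than [D] independent exponents would be initial in [D.+1] elements of [F], which
    [initial_alg_indep] makes algebraically independent. *)
Lemma rank_exponent_mx_le (K : fieldType) N (le : rel 'X_{1..N})
    (F : seq {mpoly K[N]}) (T : seq 'X_{1..N}) D :
    monomial_order le ->
    (forall a, a \in T -> exists2 p, p \in F & is_initial le p a) ->
    (forall x : 'I_D.+1 -> {mpoly K[N]}, (forall i, x i \in gen_subalg (mem F)) ->
      exists2 p : {mpoly K[D.+1]}, p != 0 & mmap (in_alg {mpoly K[N]}) x p = 0) ->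
  (\rank (exponent_mx T) <= D)%N.
Proof.
move=> le_ord TF dep; rewrite leqNgt; apply/negP=> lt_D.
pose h (i : 'I_D.+1) := maxrankfun (exponent_mx T) (widen_ord lt_D i).
pose a i := nth 0%MM T (h i).
have /choice[x xP] : forall i, exists p, p \in F /\ is_initial le p (a i).
  by move=> i; have [|p pF pa] := TF (a i); [rewrite mem_nth | exists p].
have [i|p p0] := dep x; first by apply: mem_gen_subalg; case: (xP i).
have -> : mmap (in_alg {mpoly K[N]}) x p = mmap (@mpolyC N K) x p.
  by apply: eq_mmap => // c /=; rewrite alg_mpolyC.
apply/eqP; apply: (initial_alg_indep le_ord (a := a)) p0 => [i|u v euv].
  by case: (xP i).
have free : row_free (rowsub h (exponent_mx T)).
  rewrite /h (_ : rowsub _ _ = rowsub (widen_ord lt_D)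
    (rowsub (maxrankfun (exponent_mx T)) (exponent_mx T))); last first.
    by apply/matrixP=> i j; rewrite !mxE.
  apply: row_free_rowsub; last exact: maxrowsub_free.
  by move=> i j /(congr1 val) /= e; apply: val_inj.
apply/mnmP=> i; apply/eqP; rewrite -(eqr_nat rat); apply/eqP.
suff /row_free_inj/rowP/(_ i) : mnm_row u *m rowsub h (exponent_mx T) =
    mnm_row v *m rowsub h (exponent_mx T) by move/(_ free); rewrite !mxE.
have sumE w : mnm_row w *m rowsub h (exponent_mx T) = mnm_row (\sum_(i < D.+1) a i *+ w i)%MM.
  apply/rowP=> j; rewrite !mxE mnm_sumE natr_sum; apply: eq_bigr => k _.
  by rewrite !mxE mulmnE natrM mulrC.
by rewrite !sumE euv.
Qed.

(** * Linkage *)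

Lemma exists_subset_card (I : finType) (A : {set I}) k :
  (k <= #|A|)%N -> exists2 B : {set I}, B \subset A & #|B| = k.
Proof.
move=> le_k; exists [set x in take k (enum A)].
  by apply/subsetP=> x; rewrite inE => /mem_take; rewrite mem_enum.
have/card_uniqP e : uniq (take k (enum A)) by rewrite take_uniq ?enum_uniq.
by rewrite cardsE e size_takel // -cardE.
Qed.

Lemma eq_mxvec_index m n (i k : 'I_m) (j l : 'I_n) :
  (mxvec_index i j == mxvec_index k l) = (i == k) && (j == l).
Proof.
rewrite -xpair_eqE; apply/eqP/eqP=> [e|[-> ->] //].
have [g gK _] := curry_mxvec_bij m n.
by rewrite -(gK (i, j)) ?inE // -[RHS]gK ?inE //= e.
Qed.

Section Transversals.
Variables m n : nat.
Implicit Types h : {ffun 'I_m -> 'I_n}.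

Definition transversal_mnm h : 'X_{1..(m * n)} :=
  (\sum_(i < m) U_(mxvec_index i (h i)))%MM.

Lemma transversal_mnmE h i j : transversal_mnm h (mxvec_index i j) = (h i == j).
Proof.
rewrite mnm_sumE (bigD1 i) //= big1 => [|k ki].
  by rewrite addn0 mnm1E eq_mxvec_index eqxx.
by rewrite mnm1E eq_mxvec_index (negPf ki).
Qed.

Lemma transversal_mnm_inj : injective transversal_mnm.
Proof.
move=> h h' e; apply/ffunP=> i; apply/esym/eqP.
have /mnmP/(_ (mxvec_index i (h i))) := e; rewrite !transversal_mnmE eqxx.
by case: (h' i == h i).
Qed.

Definition entry_row (i : 'I_m) (j : 'I_n) : 'rV[rat]_(m * n) :=
  mnm_row U_(mxvec_index i j).

Lemma transversal_row h :
  mnm_row (transversal_mnm h) = \sum_i entry_row i (h i).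
Proof.
rewrite /transversal_mnm /entry_row.
by elim/big_ind2: _ => [|a u b v <- <-|//]; rewrite ?mnm_row0 ?mnm_rowD.
Qed.

Section Rank.
Variables (le : rel 'X_{1..(m * n)}) (T : seq 'X_{1..(m * n)}).
Hypothesis le_ord : monomial_order le.
Hypotheses (m_gt0 : (0 < m)%N) (le_mn : (m <= n)%N).

Definition into h (S : {set 'I_n}) := injective h /\ forall i, h i \in S.

(** Coherence in terms of transversals: the initial monomial of the minor on [S] is the largest
    transversal of [S]. *)
Hypothesis initialT : forall S : {set 'I_n}, #|S| = m -> exists h,
  [/\ into h S, transversal_mnm h \in T &
      forall h', into h' S -> le (transversal_mnm h') (transversal_mnm h)].

Local Notation V := (exponent_mx T).

(* Linkage. Take c' in C maximizing in(C \ c') X_(i, c') and let c be the column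
   of row i in in(C \ c'). Moving row i to c' yields a transversal of C \ c,
   which maximality forces to be in(C \ c). *)
Lemma linkage (C : {set 'I_n}) (i : 'I_m) : #|C| = m.+1 ->
  exists c c', [/\ c \in C, c' \in C, c != c' &
                   (entry_row i c - entry_row i c' <= V)%MS].
Proof.
move=> cardC.
have /choice[f fP] : forall c, exists h, c \in C ->
    [/\ into h (C :\ c), transversal_mnm h \in T &
      forall h', into h' (C :\ c) -> le (transversal_mnm h') (transversal_mnm h)].
  move=> c; case: (boolP (c \in C)) => [cC|_]; last by exists [ffun=> c].
  have [|h hP] := initialT (S := C :\ c); last by exists h.
  by move: cardC; rewrite (cardsD1 c) cC => -[].
pose key c := (transversal_mnm (f c) + U_(mxvec_index i c))%MM.
have [|c' c'C max] := exists_max_seq key (mnm_le_total le_ord) (mnm_le_trans le_ord)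
   (s := enum C).
  by rewrite -size_eq0 -cardE cardC.
rewrite mem_enum in c'C; have {}max c : c \in C -> le (key c) (key c').
  by move=> cC; apply: max; rewrite mem_enum.
have [[inj_h hC] hT hmax] := fP _ c'C; set h := f c' in inj_h hC hT hmax.
have [ne_c cC] : h i != c' /\ h i \in C by move: (hC i); rewrite !inE => /andP.
exists (h i), c'; split=> //.
pose h' := [ffun k => if k == i then c' else h k].
have eh' : (transversal_mnm h' + U_(mxvec_index i (h i)) =
            transversal_mnm h + U_(mxvec_index i c'))%MM.
  rewrite /transversal_mnm (bigD1 i) //= [in RHS](bigD1 i) //= ffunE eqxx.
  rewrite (eq_bigr (fun k => U_(mxvec_index k (h k))%MM)) => [|k /negPf ki].
    by rewrite addmC -[RHS]addmA; congr (_ + _)%MM; apply: addmC.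
  by rewrite ffunE ki.
have into_h' : into h' (C :\ h i).
  split=> [k l|k].
    rewrite !ffunE; case: eqP => [->|_]; case: eqP => [->|_] // e.
    - by have := hC l; rewrite -e !inE eqxx.
    - by have := hC k; rewrite e !inE eqxx.
    - exact: inj_h.
  rewrite !inE ffunE; have [_|ki] := eqVneq k i; first by rewrite eq_sym ne_c.
  by rewrite (inj_eq inj_h) ki; move: (hC k); rewrite !inE => /andP[].
have [_ h1T h1max] := fP _ cC.
(* By [eh'], maximality of [c'] says that [h'] times X_(i, h i) is at least [f (h i)] times the same
   variable, which cancels. The converse is [h1max]. *)
have eh1 : transversal_mnm h' = transversal_mnm (f (h i)).
  apply: (mnm_le_anti le_ord); rewrite h1max //=.
  by rewrite -(mnm_le_add2r le_ord U_(mxvec_index i (h i))) eh' max.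
have -> : entry_row i (h i) - entry_row i c' =
    mnm_row (transversal_mnm h) - mnm_row (transversal_mnm h').
  apply/eqP; rewrite subr_eq addrAC eq_sym subr_eq -!mnm_rowD.
  by rewrite -eh' addmC.
by rewrite addmx_sub ?eqmx_opp ?mnm_row_exponent_mx // eh1.
Qed.

(** A normal form modulo [V]: equivalent entries of a row have the same set of equivalents, from
    which [pick] selects the same element. *)
Let rep i c := odflt c [pick b | (entry_row i c - entry_row i b <= V)%MS].

Let rep_sub i c : (entry_row i c - entry_row i (rep i c) <= V)%MS.
Proof. by rewrite /rep; case: pickP => //= _; rewrite subrr sub0mx. Qed.

Let eq_rep i b c : (entry_row i b - entry_row i c <= V)%MS -> rep i b = rep i c.
Proof.
move=> bc; rewrite /rep (@eq_pick _ _ [pred x | (entry_row i c - entry_row i x <= V)%MS]).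
  by case: pickP => //= /(_ c) /=; rewrite subrr sub0mx.
move=> x /=; apply/idP/idP=> h.
  rewrite -(subrKA (entry_row i b)) addmx_sub // -opprB eqmx_opp //.
by rewrite -(subrKA (entry_row i c)) addmx_sub.
Qed.

Let reps i := [set rep i c | c in [set: 'I_n]].

(** Distinct representatives are inequivalent modulo [V], whereas [linkage] finds two equivalent
    entries among any [m.+1] columns. *)
Let card_reps i : (#|reps i| <= m)%N.
Proof.
rewrite leqNgt; apply/negP=> /exists_subset_card[C /subsetP sC cardC].
have repK c : c \in C -> rep i c = c.
  by move=> /sC/imsetP[b _ ->]; rewrite -(eq_rep (rep_sub i b)).
have [c [c' [cC c'C /eqP ne_c /eq_rep e]]] := linkage i cardC.
by case: ne_c; rewrite -(repK c) // e repK.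
Qed.

(* Modulo V each entry is equivalent to one of at most m^2 representatives, and
   the relation given by an element of T makes one of those superfluous. *)
Lemma rank_exponent_mx_ge : (m * n < \rank V + m * m)%N.
Proof.
have [|S _ cardS] := @exists_subset_card _ [set: 'I_n] m; first by rewrite cardsT card_ord.
have [h [_ hT _]] := initialT cardS.
pose i0 := Ordinal m_gt0; pose p0 := (i0, rep i0 (h i0)).
pose P0 := [set p : 'I_m * 'I_n | p.2 \in reps p.1]; pose P := P0 :\ p0.
have p0P : p0 \in P0 by rewrite inE /= imset_f.
have cardP : (#|P| < m * m)%N.
  have -> : #|P|.+1 = #|P0| by rewrite (cardsD1 p0 P0) p0P.
  have -> : #|P0| = (\sum_i #|reps i|)%N.
    rewrite -sum1_card (eq_bigr (fun i => \sum_(j in reps i) 1)%N); last first.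
      by move=> i _; rewrite sum1_card.
    by rewrite pair_big_dep /=; apply: eq_bigl => p; rewrite inE.
  apply: (@leq_trans (\sum_(i < m) m)); last by rewrite sum_nat_const card_ord.
  by apply: leq_sum => i _; apply: card_reps.
pose W := \matrix_(k < #|P|) entry_row (enum_val k).1 (enum_val k).2.
have inW i b : b \in reps i -> (i, b) != p0 -> (entry_row i b <= V + W)%MS.
  move=> bi ne_p; have ibP : (i, b) \in P by rewrite !inE ne_p.
  apply: submx_trans (addsmxSr V W).
  have := row_sub (enum_rank_in ibP (i, b)) W.
  by rewrite rowK enum_rankK_in.
have subV u : (u <= V)%MS -> (u <= V + W)%MS by move=> uV; apply: submx_trans (addsmxSl V W).
have reduce i j : (entry_row i (rep i j) <= V + W)%MS -> (entry_row i j <= V + W)%MS.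
  move=> repW; rewrite -[entry_row i j](subrK (entry_row i (rep i j))).
  by rewrite addmx_sub // subV.
(* The element of [T] puts the sum of the entries along [h] in [V]. Those outside row [i0] lie in
   [V + W], hence so does the one in row [i0], and with it its representative. *)
have p0W : (entry_row i0 (rep i0 (h i0)) <= V + W)%MS.
  have := mnm_row_exponent_mx hT; rewrite transversal_row (bigD1 i0) //= => /subV sum_h.
  rewrite -[entry_row _ _](subKr (entry_row i0 (h i0))) addmx_sub //; last first.
    by rewrite eqmx_opp subV.
  rewrite -[entry_row _ _](addrK (\sum_(i | i != i0) entry_row i (h i))).
  rewrite addmx_sub // eqmx_opp summx_sub // => i ne_i; apply: reduce.
  by rewrite inW ?imset_f // xpair_eqE (negPf ne_i).
have full : (1%:M <= V + W)%MS.
  apply/row_subP=> k; case/mxvec_indexP: k => i j.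
  have -> : row (mxvec_index i j) 1%:M = entry_row i j.
    by apply/rowP=> k; rewrite !mxE mnm1E.
  apply: reduce; have [e|] := eqVneq (i, rep i j) p0; last by apply: inW; rewrite imset_f.
  by case: e => -> ->.
have := mxrankS full; rewrite mxrank1 => le_mn_rank.
apply: leq_ltn_trans le_mn_rank _.
apply: leq_ltn_trans (mxrank_adds_leqif V W) _.
by rewrite ltn_add2l (leq_ltn_trans (rank_leq_row W)).
Qed.

End Rank.
End Transversals.

(** * Supports of maximal minors *)

Lemma increasing_enum m n (S : {set 'I_n}) : #|S| = m ->
  exists2 g : {ffun 'I_m -> 'I_n}, increasing g & forall j, (j \in S) = (j \in codom g).
Proof.
move=> <-; exists [ffun i => enum_val i] => [|j].
  apply/increasingP=> i j lt_ij; rewrite !ffunE.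
  rewrite /enum_val (set_nth_default (enum_default j)) -?cardE //.
  have sorted_S : sorted (relpre val ltn) (enum S).
    rewrite /enum_mem -enumT; apply: sorted_filter => [x y z|]; first exact: ltn_trans.
    by rewrite -sorted_map val_enum_ord iota_ltn_sorted.
  by apply: (sorted_ltn_nth _ _ sorted_S) => [x y z|||];
    rewrite ?inE -?cardE //; apply: ltn_trans.
apply/idP/codomP=> [jS|[i ->]]; last by rewrite ffunE enum_valP.
by exists (enum_rank_in jS j); rewrite ffunE enum_rankK_in.
Qed.

Section SupportMinor.
Variables (K : fieldType) (m n : nat) (g : {ffun 'I_m -> 'I_n}).

Lemma minor_expansion : \det (colsub g (generic_mx K m n)) =
  \sum_(s : {perm 'I_m}) (-1) ^+ s *: 'X_[transversal_mnm [ffun i => g (s i)]].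
Proof.
apply: eq_bigr => s _; rewrite /transversal_mnm -mprodXE.
rewrite -mul_mpolyC rmorphXn rmorphN rmorph1; congr (_ * _).
by apply: eq_bigr => i _; rewrite !mxE ffunE.
Qed.

Lemma minor_support a : a \in msupp (\det (colsub g (generic_mx K m n))) ->
  exists s : {perm 'I_m}, a = transversal_mnm [ffun i => g (s i)].
Proof.
rewrite mcoeff_msupp minor_expansion raddf_sum /= => a0.
have [/existsP[s /eqP->]|/existsPn none] :=
  boolP [exists s : {perm 'I_m}, a == transversal_mnm [ffun i => g (s i)]].
  by exists s.
case/eqP: a0; apply: big1 => s _.
by rewrite mcoeffZ mcoeffX eq_sym (negPf (none s)) mulr0.
Qed.

Hypothesis g_inj : injective g.

(** As [g] is injective, different permutations give different monomials, so the coefficient is a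
    single sign. *)
Lemma mem_minor_support (s : {perm 'I_m}) :
  transversal_mnm [ffun i => g (s i)] \in msupp (\det (colsub g (generic_mx K m n))).
Proof.
rewrite mcoeff_msupp minor_expansion raddf_sum /= (bigD1 s) //= big1 => [|t ts].
  by rewrite mcoeffZ mcoeffX eqxx mulr1 addr0 signr_eq0.
rewrite mcoeffZ mcoeffX; case: eqP => [/transversal_mnm_inj/ffunP e|]; last by rewrite mulr0.
case/eqP: ts; apply/permP=> i; apply: g_inj.
by have := e i; rewrite !ffunE.
Qed.

End SupportMinor.

(** An injective map into [S] is a permutation followed by the increasing enumeration [g] of [S], so
    every transversal of [S] occurs in the minor and is bounded by its initial monomial. *)
Lemma initial_transversal (K : fieldType) m n (le : rel 'X_{1..(m * n)})
    (T : seq 'X_{1..(m * n)}) :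
    (forall p, p \in minors m (generic_mx K m n) ->
       exists2 a, a \in T & is_initial le p a) ->
  forall S : {set 'I_n}, #|S| = m -> exists h : {ffun 'I_m -> 'I_n},
    [/\ into h S, transversal_mnm h \in T &
        forall h', into h' S -> le (transversal_mnm h') (transversal_mnm h)].
Proof.
move=> initT S /increasing_enum[g incg gS].
have g_inj := increasing_inj incg.
have [|a aT /andP[ag /allP amax]] := initT (\det (colsub g (generic_mx K m n))).
  by apply/mem_minors; exists g.
have [s es] := minor_support ag; rewrite {a}es in aT ag amax.
exists [ffun i => g (s i)]; split=> // [|h' [h'_inj h'S]].
  split=> [i j|i]; last by rewrite ffunE gS codom_f.
  by rewrite !ffunE => /g_inj/perm_inj.
have /choice[t tP] : forall i, exists k, h' i = g k.
  by move=> i; apply/codomP; rewrite -gS.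
have t_inj : injective t by move=> i j e; apply: h'_inj; rewrite !tP e.
have -> : h' = [ffun i => g (perm t_inj i)] by apply/ffunP=> i; rewrite ffunE permE.
exact/amax/mem_minor_support.
Qed.

(** * From matchings to the equality of dimensions *)

Lemma all2_mem1 (A B : eqType) (r : A -> B -> bool) s t x :
  all2 r s t -> x \in s -> exists2 y, y \in t & r x y.
Proof.
elim: s t => [|a s IHs] [|b t] //= /andP[rab /IHs rst].
rewrite inE => /predU1P[->|/rst[y yt rxy]]; first by exists b; rewrite ?mem_head.
by exists y; rewrite // inE yt orbT.
Qed.

Lemma all2_mem2 (A B : eqType) (r : A -> B -> bool) s t y :
  all2 r s t -> y \in t -> exists2 x, x \in s & r x y.
Proof.
elim: s t => [|a s IHs] [|b t] //= /andP[rab /IHs rst].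
rewrite inE => /predU1P[->|/rst[x xs rxy]]; first by exists a; rewrite ?mem_head.
by exists x; rewrite // inE xs orbT.
Qed.

Theorem theorem6p1 (K : fieldType) (m n : nat) (m_gt0 : (0 < m)%N)
    (le_mn : (m <= n)%N) (T : seq 'X_{1..(m * n)}) :
  let M := minors m (generic_mx K m n) in
  coherent_matching M T ->
  krull_dim (subalg_of (mem (monomials K T))) = krull_dim (subalg_of (mem M)).
Proof.
move=> M [_ [le [le_ord initT]]].
have ge := rank_exponent_mx_ge le_ord m_gt0 le_mn
  (initial_transversal (fun p => all2_mem1 initT (x := p))).
have le_dep D := rank_exponent_mx_le (D := D) le_ord (fun a => all2_mem2 initT (y := a)).
rewrite krull_dim_monomials; move: @M T le {le_ord initT} ge le_dep.
case: m m_gt0 le_mn => // m' _; set m1 := m'.+1 => le_mn.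
rewrite -(subnKC le_mn); move: (n - m1)%N => r M T le ge le_dep.
have dep := subalg_alg_dep (@normal_mx_inj K m' r).
rewrite (@krull_dim_eq _ (m1 * r).+1); last first.
- exact: leq_prime_chain.
- exact: minors_prime_chain.
(* The upper bound is [le_dep]; the lower bound is [ge], as m1 (m1 + r) < rank + m1^2 amounts to m1
   r < rank. *)
congr Some; apply/eqP; rewrite eqn_leq le_dep //=.
by rewrite -(ltn_add2r (m1 * m1)) addnC -mulnDr.
Qed.
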